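(* Let $\mathfrak{H}$ be a separable Hilbert space with an orthogonal decomposition $\mathfrak{H}=\mathfrak{H}_0\oplus\mathfrak{H}_1$, let $A_0$, $A_1$ be bounded self-adjoint operators on $\mathfrak{H}_0$, $\mathfrak{H}_1$ respectively, let $V:\mathfrak{H}_1\to\mathfrak{H}_0$ be a bounded operator, and let $\lambda\in\mathbb{R}$ satisfy $\sup\mathrm{spec}(A_0)\le\lambda\le\inf\mathrm{spec}(A_1)$. Put $$\mathbf{A}=\begin{pmatrix}A_0&0\\0&A_1\end{pmatrix},\qquad \mathbf{B}=\begin{pmatrix}A_0&V\\ V^*&A_1\end{pmatrix},$$ $$\delta_-=\inf\mathrm{spec}(\mathbf{A})-\inf\mathrm{spec}(\mathbf{B}),\qquad \delta_+=\sup\mathrm{spec}(\mathbf{B})-\sup\mathrm{spec}(\mathbf{A}),\qquad \delta=\max\{\delta_-,\delta_+\}.$$ Let $\mathfrak{Q}=\mathrm{Ran}\,\mathsf{E}_{\mathbf{B}}((-\infty,\lambda))\oplus\big(\mathrm{Ran}\,\mathsf{E}_{\mathbf{B}}(\{\lambda\})\cap\mathfrak{H}_0\big)$ and let $X:\mathfrak{H}_0\to\mathfrak{H}_1$ be the contraction with $\mathcal{G}(\mathfrak{H}_0,X)=\mathfrak{Q}$. Let $P$ and $Q$ be the orthogonal projections in $\mathfrak{H}$ onto $\mathfrak{H}_0$ and $\mathfrak{Q}$, respectively. Then $\delta\le\|V\|$ and (the quotients below being understood for $V\neq0$) $$\|X\|\ge\frac{\delta}{\|V\|},$$ equivalently,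 $$\|Q-P\|\ge\frac{\delta}{\sqrt{\delta^2+\|V\|^2}}.$$
   Context: $\mathrm{spec}(T)$ denotes the spectrum of $T$, and $\mathsf{E}_{\mathbf{B}}(\Delta)$ the spectral projection of the self-adjoint operator $\mathbf{B}$ for the Borel set $\Delta\subset\mathbb{R}$. For an operator $X:\mathfrak{H}_0\to\mathfrak{H}_1$, its graph is $\mathcal{G}(\mathfrak{H}_0,X)=\{x\oplus Xx\mid x\in\mathfrak{H}_0\}$. Under the stated hypotheses it is known that $\mathfrak{Q}$ is the graph of a (necessarily unique) operator $X$ with $\|X\|\le1$, and that $X$ solves the Riccati equation $A_1X-XA_0-XVX+V^*=0$; moreover $\delta_-\ge0$ and $\delta_+\ge0$. *)

(* Defs.v *)
From HB Require Import structures.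
From mathcomp Require Import all_boot all_order all_algebra sesquilinear.
From mathcomp Require Import complex.
From mathcomp Require Import all_classical all_reals all_analysis.
Import Order.TTheory GRing.Theory Num.Theory.
Import numFieldNormedType.Exports.

Set Implicit Arguments.
Unset Strict Implicit.
Unset Printing Implicit Defensive.

Local Open Scope classical_set_scope.
Local Open Scope ring_scope.
Local Open Scope complex_scope.

(* The inner product is linear in its first argument and conjugate-linear in
   the second one; the norm of a normedModType R[i] takes its values in the
   nonnegative reals of R[i]. *)
HB.mixin Record CompleteNormedModule_isHilbert (R : realType) V
    of CompleteNormedModule R[i] V := {
  inner : {dot V for (Num.conj : R[i] -> R[i])} ;
  inner_normE : forall x : V, `|x| ^+ 2 = inner x x }.

#[short(type="hilbertType")]
HB.structure Definition Hilbert (R : realType) :=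
  { V of CompleteNormedModule R[i] V & CompleteNormedModule_isHilbert R V }.

Definition separable (T : topologicalType) :=
  exists2 D : set T, countable D & dense D.

Definition opnorm (R : realType) (H K : hilbertType R) (T : H -> K) : R :=
  sup [set complex.Re `|T x| | x in [set x | `|x| <= 1]].

Definition adjoint (R : realType) (H K : hilbertType R)
    (T : H -> K) (T' : K -> H) :=
  forall x y, inner (T x) y = inner x (T' y).

Definition selfadjoint (R : realType) (H : hilbertType R) (T : H -> H) :=
  adjoint T T.

Definition spectrum (R : realType) (H : hilbertType R) (T : H -> H) :
    set R[i] :=
  [set z | ~ exists S : {linear H -> H}, continuous S /\
     forall x, S (T x - z *: x) = x /\ T (S x) - z *: S x = x].

(* inf spec(T) and sup spec(T) for a self-adjoint T, whose spectrum is real;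
   with the values +oo and -oo when the spectrum is empty, i.e. on {0}. *)
Definition inf_spec (R : realType) (H : hilbertType R) (T : H -> H) : \bar R :=
  ereal_inf [set t%:E | t in [set t : R | spectrum T t%:C]].

Definition sup_spec (R : realType) (H : hilbertType R) (T : H -> H) : \bar R :=
  ereal_sup [set t%:E | t in [set t : R | spectrum T t%:C]].

(* P is the orthogonal projection onto the closed subspace S. *)
Definition orth_proj_onto (R : realType) (H : hilbertType R)
    (P : H -> H) (S : set H) :=
  forall x, S (P x) /\ forall y, S y -> inner (x - P x) y = 0.

Record projection_valued_measure (R : realType) (H : hilbertType R)
    (E : set (measurableTypeR R) -> {linear H -> H}) : Prop := {
  pvm_proj : forall D, measurable D -> orth_proj_onto (E D) (range (E D)) ;
  pvm_setT : forall x, E setT x = x ;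
  pvm_sigma_additive : forall F : (set (measurableTypeR R))^nat,
    (forall n, measurable (F n)) -> trivIset setT F -> forall x,
    (fun n => \sum_(k < n) E (F k) x) @ \oo --> E (\bigcup_n F n) x }.

(* E is the spectral measure of the bounded self-adjoint operator B, i.e. B is
   the integral of t with respect to dE(t): every x lies in the domain of that
   integral (t^2 is integrable for the scalar measure D |-> <E(D)x, x>), and
   <Bx, x> is the integral of t with respect to this scalar measure.  The
   off-diagonal <Bx, y> are then given by polarization. *)
Definition spectral_measure_of (R : realType) (H : hilbertType R)
    (B : H -> H) (E : set (measurableTypeR R) -> {linear H -> H}) :=
  projection_valued_measure E /\
  forall x, exists mu : {measure set (measurableTypeR R) -> \bar R},
    [/\ forall D, measurable D -> mu D = (complex.Re (inner (E D x) x))%:E,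
        mu.-integrable setT (fun t => (t ^+ 2)%:E) &
        inner (B x) x = (\int[mu]_(t in setT) t)%R%:C].

(* H is the orthogonal sum of the (closed) subspaces range J0 and range J1,
   identified with the Hilbert spaces H0 and H1 through the isometric
   embeddings J0 and J1. *)
Record orth_decomposition (R : realType) (H H0 H1 : hilbertType R)
    (J0 : {linear H0 -> H}) (J1 : {linear H1 -> H}) : Prop := {
  orth_isom0 : forall x y, inner (J0 x) (J0 y) = inner x y ;
  orth_isom1 : forall x y, inner (J1 x) (J1 y) = inner x y ;
  orth_orth : forall x y, inner (J0 x) (J1 y) = 0 ;
  orth_span : forall h, exists x y, h = J0 x + J1 y }.

(* T is the operator with block matrix (T00 T01 // T10 T11). *)
Definition block_operator (R : realType) (H H0 H1 : hilbertType R)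
    (J0 : H0 -> H) (J1 : H1 -> H) (T : H -> H)
    (T00 : H0 -> H0) (T01 : H1 -> H0) (T10 : H0 -> H1) (T11 : H1 -> H1) :=
  forall x y, T (J0 x + J1 y) = J0 (T00 x + T01 y) + J1 (T10 x + T11 y).

Definition graph (R : realType) (H H0 H1 : hilbertType R)
    (J0 : H0 -> H) (J1 : H1 -> H) (X : H0 -> H1) : set H :=
  [set J0 x + J1 (X x) | x in setT].

(* delta_-, delta_+ and delta: real numbers (0 when H = {0}). *)
Definition delta_minus (R : realType) (H : hilbertType R) (A B : H -> H) : R :=
  fine (inf_spec A) - fine (inf_spec B).

Definition delta_plus (R : realType) (H : hilbertType R) (A B : H -> H) : R :=
  fine (sup_spec B) - fine (sup_spec A).

Definition delta (R : realType) (H : hilbertType R) (A B : H -> H) : R :=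
  Num.max (delta_minus A B) (delta_plus A B).

Definition frakQ (R : realType) (H H0 : hilbertType R) (J0 : H0 -> H)
    (E : set (measurableTypeR R) -> {linear H -> H}) (lambda : R) : set H :=
  [set u + v | u in range (E [set t | t < lambda]) &
               v in range (E [set lambda]) `&` range J0].

(* Main.v *)
Require Import Defs.
From HB Require Import structures.
From mathcomp Require Import all_boot all_order all_algebra sesquilinear.
From mathcomp Require Import complex measurable_realfun ring lra.
From mathcomp Require Import all_classical all_reals all_analysis.
Import Order.TTheory GRing.Theory Num.Theory.
Import numFieldNormedType.Exports.

Set Implicit Arguments.
Unset Strict Implicit.
Unset Printing Implicit Defensive.

Local Open Scope classical_set_scope.
Local Open Scope ring_scope.

(** Why the theorem holds.  Write v and k for the norms of V and X.  Everything
    follows from the two inequalities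
      [inf spec A - inf spec B <= v k]  and  [sup spec B - sup spec A <= v k],
    that is, [delta <= v k]: the bound on [opnorm X] is a division by v, and
    [delta <= v] holds because [k <= 1].

    The subspace frakQ reduces B, so the form of B is bounded below by any
    number that bounds it below on frakQ and on its orthogonal complement.
    On the complement, which lies in the spectral subspace of [[lambda, oo)],
    the form is at least [lambda], and lambda lies above the bottom of A because
    A0 is at most lambda.  On frakQ a vector is [q = (x, X x)], and the first
    component of [B q] is [A0 x + V X x], which differs from [A0 x] by at most
    [v k |x|].  If the bottom b of B on frakQ were below [inf A - v k], then
    for all q in frakQ the norm of [(B - b) q] would be at least a positive
    multiple of [|x|], hence of [|q|]; for a nonnegative symmetric operator this
    bound from below on norms forces a positive bound from below on the form
    ([form_gap]), so b would not be the bottom.  This is the perturbation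
    argument for the operator [A0 + V X], which is similar to the restriction of
    B to frakQ, with the bottom of the form in the place of approximate
    eigenvectors ([form_ge_compression]).  The second inequality is the first
    one for [- B], [- A] and the complement of frakQ; a vector [(x, y)]
    orthogonal to the graph of X satisfies [|x| <= k |y|], which stands in for
    the adjoint of X.

    Spectra enter only through [inf_spec_form]: for a bounded self-adjoint T on
    a nonzero space, [inf spec T] is the greatest lower bound m of the form of
    T.  Indeed [T - m] has no bounded inverse, again by [form_gap], and
    [T - t] is coercive, hence invertible, when [t < m].  If one of the two
    summands of H is zero, then A = B and delta vanishes.

    Finally [Q - P] maps [(x, X x)] to [(0, X x)], so that n, the norm of
    [Q - P], satisfies [k^2 (1 - n^2) <= n^2] as soon as [n < 1]
    ([opnorm_graph_le]).  With [delta <= v k] this is the second quotient. *)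

(** * The real inner product *)

(** Norms in a complex Hilbert space are complex numbers.  Real parts give
    the real Hilbert space structure, which is all the argument uses: symmetry,
    orthogonality and the values of the form of a symmetric operator survive. *)
Definition rnorm (R : realType) (H : hilbertType R) (x : H) : R :=
  complex.Re `|x|.

Definition rinner (R : realType) (H : hilbertType R) (x y : H) : R :=
  complex.Re (inner x y).

Section RealForm.
Local Open Scope complex_scope.
Variables (R : realType) (H : hilbertType R).
Implicit Types (x y z : H) (t : R).

Lemma normE x : `|x| = (rnorm x)%:C.
Proof. by rewrite /rnorm RRe_real // normr_real. Qed.

Lemma rnorm_ge0 x : 0 <= rnorm x.
Proof. by rewrite -ler0c -normE normr_ge0. Qed.

Lemma rnorm_sqr x : rnorm x ^+ 2 = rinner x x.
Proof. by rewrite /rinner -inner_normE normE -rmorphXn. Qed.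

Lemma rinnerC x y : rinner x y = rinner y x.
Proof.
rewrite /rinner (hermC (inner : {hermitian _ for _ & _})) /= expr0 mul1r.
by case: (inner y x).
Qed.

Lemma rinnerDl x y z : rinner (x + y) z = rinner x z + rinner y z.
Proof. by rewrite /rinner linearDl raddfD. Qed.

Lemma rinnerDr x y z : rinner z (x + y) = rinner z x + rinner z y.
Proof. by rewrite /rinner linearDr raddfD. Qed.

Lemma rinnerNl x y : rinner (- x) y = - rinner x y.
Proof. by rewrite /rinner linearNl raddfN. Qed.

Lemma rinnerNr x y : rinner x (- y) = - rinner x y.
Proof. by rewrite /rinner linearNr raddfN. Qed.

Lemma rinnerZl t x y : rinner (t%:C *: x) y = t * rinner x y.
Proof.
rewrite /rinner linearZl_LR /=; case: (inner x y) => a b /=.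
by rewrite mul0r subr0.
Qed.

Lemma rinnerZr t x y : rinner x (t%:C *: y) = t * rinner x y.
Proof. by rewrite rinnerC rinnerZl rinnerC. Qed.

Lemma rnormN x : rnorm (- x) = rnorm x.
Proof. by rewrite /rnorm normrN. Qed.

Lemma rnormZ t x : rnorm (t%:C *: x) = `|t| * rnorm x.
Proof.
apply: complexI; rewrite -normE normrZ normE rmorphM; congr (_ * _).
by rewrite normc_def /= expr0n addr0 sqrtr_sqr.
Qed.

Lemma rnormD x y : rnorm (x + y) <= rnorm x + rnorm y.
Proof. by have := ler_normD x y; rewrite !normE -rmorphD /= lecR. Qed.

Lemma rnorm_eq0 x : rnorm x = 0 -> x = 0.
Proof. by move=> x0; apply/normr0_eq0; rewrite normE x0. Qed.

Lemma rnorm_gt0 x : (0 < rnorm x) = (x != 0).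
Proof. by rewrite -ltcR -normE normr_gt0. Qed.

Lemma rnorm0 : rnorm (0 : H) = 0.
Proof. by rewrite /rnorm normr0. Qed.

Lemma rinner0 x : rinner 0 x = 0.
Proof. by rewrite -(subrr 0) rinnerDl rinnerNl subrr. Qed.

Definition rinnerE :=
  (rnorm_sqr, rinnerDl, rinnerDr, rinnerNl, rinnerNr, rinnerZl, rinnerZr).

Lemma rinner_le x y : rinner x y <= rnorm x * rnorm y.
Proof.
have h : 2 * (rnorm x * rnorm y) * rinner x y <= 2 * (rnorm x * rnorm y) ^+ 2.
  have : 0 <= rnorm ((rnorm y)%:C *: x - (rnorm x)%:C *: y) ^+ 2.
    exact: sqr_ge0.
  rewrite !rinnerE (rinnerC y x) -!rnorm_sqr; lra.
have [xy0|] := eqVneq (rnorm x * rnorm y) 0; last first.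
  move=> xy0; have xy : 0 < rnorm x * rnorm y.
    by rewrite lt_def xy0 mulr_ge0 ?rnorm_ge0.
  by rewrite -(ler_pM2l xy); lra.
rewrite xy0; move/eqP: xy0; rewrite mulf_eq0 => /orP[]/eqP/rnorm_eq0 ->.
  by rewrite rinner0.
by rewrite rinnerC rinner0.
Qed.
End RealForm.

(** * Bounded symmetric operators and bounds of their forms *)

Section BoundedSymmetric.
Local Open Scope complex_scope.
Variables (R : realType).

Definition bounded_op (H K : hilbertType R) (T : H -> K) :=
  exists C, 0 < C /\ forall x, rnorm (T x) <= C * rnorm x.

Definition symmetric_op (H : hilbertType R) (T : H -> H) :=
  forall x y, rinner (T x) y = rinner x (T y).

Definition form_ge (H : hilbertType R) (T : H -> H) (m : R) (S : set H) :=
  forall x, S x -> m * rnorm x ^+ 2 <= rinner (T x) x.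

Definition real_subspace (H : hilbertType R) (S : set H) :=
  (forall x y, S x -> S y -> S (x + y)) /\ (forall t x, S x -> S (t%:C *: x)).

Lemma continuous_bounded_op (H K : hilbertType R) (T : {linear H -> K}) :
  continuous T <-> bounded_op T.
Proof.
split=> [/linear_bounded_continuous/linear_boundedP/pinfty_ex_gt0|].
  move=> [M M0 TM]; exists (complex.Re M).
  have ME : M = (complex.Re M)%:C by rewrite RRe_real // gtr0_real.
  split; first by rewrite -ltcR -ME.
  by move=> x; have := TM x; rewrite !normE ME -rmorphM /= lecR.
move=> [C [C0 TC]]; apply/linear_bounded_continuous/linear_boundedP.
exists C%:C; split; first by apply/complex_realP; exists C.
move=> M CM x; apply: le_trans (_ : C%:C * `|x| <= _).
  by rewrite !normE -rmorphM /= lecR.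
by rewrite ler_wpM2r // ltW.
Qed.

Definition shift (H : hilbertType R) (T : {linear H -> H}) (t : R) :
  {linear H -> H} := T \- (t%:C \*: idfun).

Variable H : hilbertType R.
Implicit Types (T D : {linear H -> H}) (S : set H).

Lemma shiftE T t x : shift T t x = T x - t%:C *: x.
Proof. by []. Qed.

Lemma bounded_opB T D : bounded_op T -> bounded_op D -> bounded_op (T \- D).
Proof.
move=> [C [C0 TC]] [C' [C'0 DC]]; exists (C + C'); split; first exact: addr_gt0.
move=> x; rewrite mulrDl /=; apply: le_trans (rnormD _ _) _.
by rewrite rnormN lerD.
Qed.

Lemma bounded_opN T : bounded_op T -> bounded_op (\- T).
Proof. by move=> [C [C0 TC]]; exists C; split=> // x; rewrite rnormN. Qed.

Lemma symmetric_opN T : symmetric_op T -> symmetric_op (\- T).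
Proof. by move=> sT x y; rewrite rinnerNl sT rinnerNr. Qed.

Lemma bounded_shift T t : bounded_op T -> bounded_op (shift T t).
Proof.
move=> bT; apply: bounded_opB => //; exists (`|t| + 1).
by split=> [|x]; rewrite ?ltr_wpDl //= rnormZ mulrDl mul1r lerDl rnorm_ge0.
Qed.

Lemma symmetric_shift T t : symmetric_op T -> symmetric_op (shift T t).
Proof. by move=> sT x y; rewrite !shiftE !rinnerE sT. Qed.

Lemma shift_form T t x :
  rinner (shift T t x) x = rinner (T x) x - t * rnorm x ^+ 2.
Proof. by rewrite shiftE !rinnerE. Qed.

Lemma shift_invariant T t S : real_subspace S ->
  (forall x, S x -> S (T x)) -> forall x, S x -> S (shift T t x).
Proof.
move=> [SD SZ] ST x Sx; rewrite shiftE -scaleNr -rmorphN.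
by apply: SD; [exact: ST|exact: SZ].
Qed.

(** Cauchy-Schwarz for the semi-inner product [<D x, y>]: the form is
    nonnegative at [x - C^-1 D x], where C bounds D. *)
Lemma nonneg_form_bound D S : bounded_op D -> symmetric_op D ->
  real_subspace S -> (forall x, S x -> S (D x)) -> form_ge D 0 S ->
  exists C, 0 < C /\ forall x, S x -> rnorm (D x) ^+ 2 <= C * rinner (D x) x.
Proof.
move=> [C [C0 DC]] sD [SD SZ] DS D0; exists C; split=> // x Sx.
have Sy : S (x + (- C^-1)%:C *: D x) by apply: SD => //; apply/SZ/DS.
have := D0 _ Sy; rewrite mul0r !linearD !linearZ /= !rinnerE.
rewrite (sD (D x) x) -rnorm_sqr => h.
have e1 : rinner (D (D x)) (D x) <= C * rnorm (D x) ^+ 2.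
  apply: le_trans (rinner_le _ _) _.
  by rewrite expr2 mulrA ler_wpM2r ?rnorm_ge0.
have {}e1 : C^-1 * (C^-1 * rinner (D (D x)) (D x)) <= C^-1 * rnorm (D x) ^+ 2.
  by rewrite ler_pM2l ?invr_gt0 // ler_pdivrMl.
have {h} : C^-1 * rnorm (D x) ^+ 2 <= rinner (D x) x by nra.
by rewrite ler_pdivrMl.
Qed.

(** If [|D x|] dominates [|x|], then so does the form of D, since [|D x|^2] is
    dominated by the form.  Hence the bottom of a form on an invariant subspace
    belongs to the spectrum. *)
Lemma form_gap D S e : bounded_op D -> symmetric_op D ->
  real_subspace S -> (forall x, S x -> S (D x)) -> form_ge D 0 S ->
  0 < e -> (forall x, S x -> e * rnorm x <= rnorm (D x)) ->
  exists e', 0 < e' /\ form_ge D e' S.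
Proof.
move=> bD sD lS DS D0 e0 eD.
have [C [C0 DC]] := nonneg_form_bound bD sD lS DS D0.
exists (C^-1 * e ^+ 2); split; first by rewrite mulr_gt0 ?invr_gt0 ?exprn_gt0.
move=> x Sx; rewrite -mulrA ler_pdivrMl // -exprMn; apply: le_trans (DC _ Sx).
by rewrite lerXn2r ?nnegrE ?mulr_ge0 ?rnorm_ge0 ?eD // ltW.
Qed.

Lemma bounded_form_ge T S : bounded_op T -> exists m, form_ge T m S.
Proof.
move=> [C [C0 TC]]; exists (- C) => x _; rewrite mulNr lerNl -rinnerNl.
apply: le_trans (rinner_le _ _) _; rewrite rnormN expr2 mulrA.
by rewrite ler_wpM2r ?rnorm_ge0.
Qed.

Lemma form_ge_le T S m m' : m' <= m -> form_ge T m S -> form_ge T m' S.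
Proof.
move=> mm' Tm x /Tm; apply: le_trans.
by rewrite ler_wpM2r ?exprn_ge0 ?rnorm_ge0.
Qed.

Lemma form_ge_sup T S (P : set R) : P !=set0 -> has_ubound P ->
  (forall b, P b -> form_ge T b S) -> form_ge T (sup P) S.
Proof.
move=> P0 uP TP x Sx; have [->|x0] := eqVneq x 0.
  by rewrite rnorm0 expr0n mulr0 linear0 rinner0.
have n0 : 0 < rnorm x ^+ 2 by rewrite exprn_gt0 // rnorm_gt0.
rewrite -ler_pdivlMr //; apply: ge_sup => // b Pb.
by rewrite ler_pdivlMr //; exact: TP.
Qed.

(** The supremum of the lower bounds of the form that do not exceed M is
    itself a lower bound; were it smaller than M, the assumed gap would increase
    it by [form_gap]. *)
Lemma form_ge_of_gaps T S M : bounded_op T -> symmetric_op T ->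
  real_subspace S -> (forall x, S x -> S (T x)) ->
  (forall b, b < M -> form_ge T b S ->
     exists e, 0 < e /\ forall x, S x -> e * rnorm x <= rnorm (shift T b x)) ->
  form_ge T M S.
Proof.
move=> bT sT lS TS gap.
pose P : set R := [set b | b <= M /\ form_ge T b S].
have P0 : P !=set0.
  have [m Tm] := bounded_form_ge S bT; exists (Num.min m M).
  by split; [rewrite ge_min lexx orbT|apply: form_ge_le Tm; rewrite ge_min lexx].
have uP : has_ubound P by exists M => b [].
have Ts : form_ge T (sup P) S by apply: form_ge_sup => // b [].
have [sM|Ms] := ltP (sup P) M; last exact: form_ge_le Ts.
have [e [e0 eT]] := gap _ sM Ts.
have D0 : form_ge (shift T (sup P)) 0 S.
  by move=> x Sx; rewrite mul0r shift_form subr_ge0; exact: Ts.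
have [e' [e'0 De']] := form_gap (bounded_shift (sup P) bT)
  (symmetric_shift (sup P) sT) lS (@shift_invariant T _ S lS TS) D0 e0 eT.
have : Num.min (sup P + e') M <= sup P.
  apply: ub_le_sup => //; split; first by rewrite ge_min lexx orbT.
  apply: (@form_ge_le _ _ (sup P + e')) => [|x Sx]; first by rewrite ge_min lexx.
  by have := De' x Sx; rewrite shift_form; lra.
by rewrite ge_min leNgt ltrDl e'0 /= leNgt sM.
Qed.

End BoundedSymmetric.

(** * Coercive operators are invertible *)

Section Inverse.
Local Open Scope complex_scope.
Variables (R : realType) (H : hilbertType R) (K : {linear H -> H}) (c : R).
Hypotheses (bK : bounded_op K) (c0 : 0 < c) (Kc : form_ge K c setT).

Lemma coercive_bounded_below x : c * rnorm x <= rnorm (K x).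
Proof.
have [x0|x0] := eqVneq (rnorm x) 0; first by rewrite x0 mulr0 rnorm_ge0.
have n0 : 0 < rnorm x by rewrite lt_def x0 rnorm_ge0.
rewrite -(ler_pM2r n0) -mulrA -expr2; apply: le_trans (rinner_le _ _).
exact: Kc.
Qed.

Lemma coercive_inj x y : K x = K y -> x = y.
Proof.
move=> Kxy; apply/subr0_eq/rnorm_eq0/le_anti; rewrite rnorm_ge0 andbT.
rewrite -(ler_pM2l c0); apply: le_trans (coercive_bounded_below _) _.
by rewrite linearB Kxy subrr rnorm0 mulr0.
Qed.

(** With C a bound of K that is at least c, the choice [s = c / C^2] minimises the bound
    [1 - 2 s c + s^2 C^2] for the square of the norm of [1 - s K]. *)
Lemma residual_contraction : exists s q : R, [/\ 0 <= q, q < 1 &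
  forall e, rnorm (e - s%:C *: K e) ^+ 2 <= q * rnorm e ^+ 2].
Proof.
have [C [C0 KC]] := bK; pose C' := Num.max C c.
have C'0 : 0 < C' by rewrite lt_max C0.
exists (c / C' ^+ 2), (1 - (c / C') ^+ 2); split.
- rewrite subr_ge0 expr_le1 ?divr_ge0 ?(ltW c0) ?(ltW C'0) // ler_pdivrMr // mul1r.
  by rewrite le_max lexx orbT.
- by rewrite ltrBlDr ltrDl exprn_gt0 // divr_gt0.
move=> e; rewrite !rinnerE (rinnerC e (K e)) -!rnorm_sqr.
have h1 := Kc (I : setT e).
have h2 : rnorm (K e) ^+ 2 <= C' ^+ 2 * rnorm e ^+ 2.
  rewrite -exprMn lerXn2r ?nnegrE ?rnorm_ge0 ?mulr_ge0 ?rnorm_ge0 ?(ltW C'0) //.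
  apply: le_trans (KC e) _.
  by rewrite ler_wpM2r ?rnorm_ge0 // le_max lexx.
have s0 : 0 < c / C' ^+ 2 by rewrite divr_gt0 // exprn_gt0.
have sC : c / C' ^+ 2 * C' ^+ 2 = c by rewrite divfK // gt_eqF // exprn_gt0.
have -> : (c / C') ^+ 2 = c / C' ^+ 2 * c.
  by rewrite expr_div_n [c ^+ 2]expr2 mulrAC.
set s := c / C' ^+ 2 in s0 sC *.
have h3 := ler_wpM2l (ltW s0) h1.
have h4 := ler_wpM2l (ltW (mulr_gt0 s0 s0)) h2.
have h5 : s * s * (C' ^+ 2 * rnorm e ^+ 2) = s * (c * rnorm e ^+ 2).
  by rewrite -sC; ring.
lra.
Qed.

(** Richardson iteration: the residuals [e n] of the approximate solutions
    [x n] decay geometrically, and [x n] is a Cauchy sequence because K is bounded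
    below. *)
Lemma coercive_surj y : exists x, K x = y.
Proof.
have [s [q [q0 q1 sq]]] := residual_contraction.
pose e n := iter n (fun v : H => v - s%:C *: K v) y.
pose x n : H := \sum_(k < n) s%:C *: e k.
have Kx n : K (x n) = y - e n.
  elim: n => [|n IH]; first by rewrite /x big_ord0 linear0 subrr.
  by rewrite /x big_ord_recr /= linearD IH linearZ /= opprB addrA addrAC.
have en n : rnorm (e n) ^+ 2 <= q ^+ n * rnorm y ^+ 2.
  elim: n => [|n IH]; first by rewrite expr0 mul1r.
  by apply: le_trans (sq _) _; rewrite (exprS q) -mulrA ler_wpM2l.
have e0 (eps : R) : 0 < eps -> \forall n \near \oo, rnorm (e n) < eps.
  move=> eps0.
  have y1 : 0 < rnorm y ^+ 2 + 1 by rewrite ltr_wpDl ?exprn_ge0 ?rnorm_ge0.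
  have qn : q ^+ n @[n --> \oo] --> (0 : R) by apply: cvg_expr; rewrite ger0_norm.
  have /cvgr0_norm_lt /(_ _ (divr_gt0 (exprn_gt0 2 eps0) y1)) := qn.
  apply: filterS => n /=; rewrite ger0_norm ?exprn_ge0 // ltr_pdivlMr // => qny.
  rewrite -(@ltr_pXn2r _ 2) ?nnegrE ?rnorm_ge0 ?(ltW eps0) //.
  apply: le_lt_trans (en n) _; apply: le_lt_trans qny.
  by rewrite ler_wpM2l ?exprn_ge0 // lerDl.
have cx : cauchy (x @ \oo).
  apply: cauchy_exP => eps eps0.
  have epsE : eps = (complex.Re eps)%:C by rewrite RRe_real // gtr0_real.
  have eps0' : 0 < c * (complex.Re eps) / 2.
    by rewrite divr_gt0 // mulr_gt0 // -ltcR -epsE.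
  have [N _ NP] := e0 _ eps0'.
  exists (x N); exists N => // n Nn /=; rewrite -ball_normE /= epsE normE ltcR.
  rewrite -(ltr_pM2l c0); apply: le_lt_trans (coercive_bounded_below _) _.
  rewrite linearB !Kx (_ : _ - _ = e n - e N); last by rewrite opprB addrC subrKA.
  apply: le_lt_trans (rnormD _ _) _; rewrite rnormN.
  by have := NP _ Nn; have := NP _ (leqnn N); rewrite /=; lra.
have /cauchy_cvgP xl := cx.
exists (limn x); apply/subr0_eq/rnorm_eq0/le_anti; rewrite rnorm_ge0 andbT.
have [C [C0 KC]] := bK.
apply/ler_addgt0Pl => d d0; rewrite addr0.
have dC : 0 < (d / 2 / C)%:C by rewrite ltcR !divr_gt0.
near \oo => n.
have -> : K (limn x) - y = K (limn x - x n) - e n.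
  by rewrite linearB Kx opprB addrA [in RHS]addrAC addrK.
apply: le_trans (rnormD _ _) _; rewrite rnormN (splitr d).
apply: lerD; last by apply: ltW; near: n; apply: e0; rewrite divr_gt0.
apply: le_trans (KC _) _; rewrite mulrC -ler_pdivlMr //.
rewrite -lecR -normE; apply: ltW; near: n.
by move/cvgrPdist_lt : xl; apply.
Unshelve. all: by end_near. Qed.

Lemma coercive_inverse : exists S : {linear H -> H},
  continuous S /\ forall x, S (K x) = x /\ K (S x) = x.
Proof.
pose f y := projT1 (cid (coercive_surj y)).
have fK y : K (f y) = y by exact: (projT2 (cid (coercive_surj y))).
have f_lin : linear f.
  by move=> a u v; apply: coercive_inj; rewrite linearP !fK.
pose S : {linear H -> H} := HB.pack f (GRing.isLinear.Build _ _ _ _ f f_lin).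
exists S; split; last first.
  by move=> x; split; [apply: coercive_inj; rewrite fK|exact: fK].
apply/continuous_bounded_op; exists c^-1; split; first by rewrite invr_gt0.
move=> x; rewrite -ler_pdivrMl ?invr_gt0 // invrK.
by apply: le_trans (coercive_bounded_below _) _; rewrite fK.
Qed.

End Inverse.

(** * The bottom of the spectrum is the bottom of the form *)

Section SpectralBounds.
Local Open Scope complex_scope.
Variables (R : realType) (H : hilbertType R).
Implicit Types (T : {linear H -> H}).

Lemma selfadjoint_symmetric T : selfadjoint T -> symmetric_op T.
Proof. by move=> sT x y; rewrite /rinner sT. Qed.

Lemma spectrumN T t : spectrum T t%:C -> spectrum (\- T) (- t)%:C.
Proof.
move=> Tt [S [cS ST]]; apply: Tt; exists (\- S); split.
  apply/continuous_bounded_op/bounded_opN; exact/continuous_bounded_op.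
move=> x; have [S1 S2] := ST x; split => /=.
  rewrite -[RHS]S1 /= -linearN; congr (S _).
  by rewrite rmorphN scaleNr opprB opprK addrC.
by rewrite -[RHS]S2 /= linearN rmorphN scaleNr scalerN.
Qed.

Lemma sup_specN T : sup_spec T = (- inf_spec (\- T)%R)%E.
Proof.
rewrite /sup_spec /inf_spec /ereal_inf oppeK; congr ereal_sup.
apply/seteqP; split=> _ [t Tt <-].
  by exists (- t)%:E; [exists (- t) => //; exact: spectrumN|rewrite /= opprK].
move: Tt => [s /= Ts <-]; exists (- s) => //=.
have -> : T = \- (\- T) :> (H -> H) by apply/funext => x /=; rewrite opprK.
exact: spectrumN.
Qed.

(** The bottom m of the form is in the spectrum because a bounded inverse of
    [T - m] would, by [form_gap], leave room to increase m; below m the operator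
    is coercive, hence invertible. *)
Lemma inf_spec_form T : (exists x : H, x != 0) ->
  bounded_op T -> symmetric_op T ->
  exists m, [/\ inf_spec T = m%:E, form_ge T m setT &
    forall b, form_ge T b setT -> b <= m].
Proof.
move=> [x0 x00] bT sT; pose P : set R := [set b | form_ge T b setT].
have P0 : P !=set0 by exact: bounded_form_ge.
have n0 : 0 < rnorm x0 ^+ 2 by rewrite exprn_gt0 // rnorm_gt0.
have uP : has_ubound P.
  exists (rinner (T x0) x0 / rnorm x0 ^+ 2) => b Pb.
  by rewrite ler_pdivlMr //; exact: Pb.
have Tm : form_ge T (sup P) setT by apply: form_ge_sup.
have m_max b : form_ge T b setT -> b <= sup P by move=> ?; exact: ub_le_sup.
have lT : @real_subspace R H setT by [].
exists (sup P); split => //; apply/le_anti/andP; split.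
  apply: ereal_inf_lbound; exists (sup P) => //= -[S [cS ST]].
  have [C [C0 SC]] : bounded_op S by apply/continuous_bounded_op.
  have D0 : form_ge (shift T (sup P)) 0 setT.
    by move=> x Sx; rewrite mul0r shift_form subr_ge0; exact: Tm.
  have DC x : setT x -> C^-1 * rnorm x <= rnorm (shift T (sup P) x).
    by move=> _; rewrite ler_pdivrMl // -[in leLHS](proj1 (ST x)).
  have Ci : 0 < C^-1 by rewrite invr_gt0.
  have [e [e0 De]] := form_gap (bounded_shift (sup P) bT)
    (symmetric_shift (sup P) sT) lT (fun _ _ => I) D0 Ci DC.
  have : sup P + e <= sup P; last by rewrite leNgt ltrDl e0.
  by apply: m_max => x Sx; have := De x Sx; rewrite shift_form; lra.
apply: le_ereal_inf_tmp => _ [t /= Tt <-]; rewrite lee_fin leNgt.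
apply/negP => tm; apply: Tt.
have tm0 : 0 < sup P - t by rewrite subr_gt0.
have Dc : form_ge (shift T t) (sup P - t) setT.
  by move=> x Sx; have := Tm x Sx; rewrite shift_form; lra.
exact: coercive_inverse (bounded_shift t bT) tm0 Dc.
Qed.

(** Changing the signs of both operators exchanges the two shifts, so that
    only infima of spectra have to be studied. *)
Lemma delta_plusN (A B : {linear H -> H}) :
  delta_plus A B = delta_minus (\- A) (\- B).
Proof.
rewrite /delta_plus (sup_specN A) (sup_specN B).
rewrite (fineN (inf_spec (\- A))) (fineN (inf_spec (\- B))).
by rewrite opprK addrC.
Qed.

Lemma inf_spec_le_form T t : (exists x : H, x != 0) ->
  bounded_op T -> symmetric_op T -> (t%:E <= inf_spec T)%E ->
  form_ge T t setT.
Proof.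
move=> H0 bT sT; have [m [-> Tm _]] := inf_spec_form H0 bT sT.
by rewrite lee_fin => tm; apply: form_ge_le Tm.
Qed.

End SpectralBounds.

(** * Spectral measures *)

Section SpectralMeasure.
Local Open Scope complex_scope.
Variables (R : realType) (H : hilbertType R).
Variable E : set (measurableTypeR R) -> {linear H -> H}.
Hypothesis pE : projection_valued_measure E.
Implicit Types (D : set (measurableTypeR R)) (x y : H).

Lemma pvm_orth D x y : measurable D -> rinner (x - E D x) (E D y) = 0.
Proof.
move=> mD; have [_ h] := pvm_proj pE mD x.
by rewrite /rinner h //; exists y.
Qed.

Lemma pvm_idem D x : measurable D -> E D (E D x) = E D x.
Proof.
move=> mD; apply/esym/subr0_eq/rnorm_eq0/eqP; rewrite -sqrf_eq0 rnorm_sqr.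
by rewrite -linearB /= {1}linearB /= pvm_orth.
Qed.

Lemma pvm_sym D x y : measurable D -> rinner (E D x) y = rinner x (E D y).
Proof.
move=> mD; have := pvm_orth x y mD; have := pvm_orth y x mD.
by rewrite !rinnerE (rinnerC y) (rinnerC (E D y)); lra.
Qed.

(** The constant sequence of empty sets has partial sums [n E(set0) x], whose
    increments tend to 0. *)
Lemma pvm_set0 x : E set0 x = 0.
Proof.
have tF : trivIset setT (fun _ : nat => set0 : set (measurableTypeR R)).
  by move=> i j _ _ [t []].
have := @pvm_sigma_additive _ _ _ pE _ (fun=> measurable0) tF x.
rewrite bigcup0 //; set u := (fun n : nat => _) => u0.
have uS0 : (fun n => u n.+1) @ \oo --> E set0 x by rewrite cvg_shiftS.
have uB0 : (fun n => u n.+1 - u n) @ \oo --> (0 : H).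
  by rewrite -(subrr (E set0 x)); exact: cvgB.
apply: norm_cvg_unique uB0; rewrite (_ : (fun n => _) = cst (E set0 x)).
  exact: cvg_cst.
by apply/funext => n; rewrite /u big_ord_recr /= [X in X - _]addrC addrK.
Qed.

Lemma pvm_setU D D' x : measurable D -> measurable D' -> D `&` D' = set0 ->
  E (D `|` D') x = E D x + E D' x.
Proof.
move=> mD mD' DD'.
have mF n : measurable (bigcup2 D D' n).
  by rewrite /bigcup2; case: ifP => // _; case: ifP.
have := DD'; rewrite trivIset_bigcup2 => tF.
have := @pvm_sigma_additive _ _ _ pE _ mF tF x; rewrite bigcup2E => h.
apply: (norm_cvg_unique h); apply: cvg_near_cst.
exists 2 => // -[|[|n]] //= _; rewrite !big_ord_recl /= big1 ?addr0 // => i _.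
by rewrite pvm_set0.
Qed.

Lemma pvm_setC D x : measurable D -> E D x + E (~` D) x = x.
Proof.
move=> mD; rewrite -pvm_setU ?setICr ?setUv ?(pvm_setT pE) //.
exact: measurableC.
Qed.

(** For z in the range of [E D], the projection [E (D `|` D')] maps z to
    [z + E D' z], and a projection cannot increase the norm. *)
Lemma pvm_disjoint D D' x : measurable D -> measurable D' ->
  D `&` D' = set0 -> E D' (E D x) = 0.
Proof.
move=> mD mD' DD'; have mU := measurableU _ _ mD mD'.
pose z := E D x.
have zD : E D z = z by exact: pvm_idem.
have : rnorm (z + E D' z) ^+ 2 = rinner z (z + E D' z).
  have -> : z + E D' z = E (D `|` D') z by rewrite pvm_setU // zD.
  by rewrite rnorm_sqr pvm_sym // pvm_idem.
rewrite !rinnerE (rinnerC (E D' z) z) => h.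
have : rinner (E D' z) (E D' z) = rinner z (E D' z).
  by rewrite pvm_sym // pvm_idem.
move=> h'; apply/rnorm_eq0/eqP; rewrite -sqrf_eq0 rnorm_sqr; apply/eqP.
rewrite -/z; lra.
Qed.


Variable B : {linear H -> H}.
Hypothesis symB : symmetric_op B.
Hypothesis EB : forall x,
  exists mu : {measure set (measurableTypeR R) -> \bar R},
    [/\ forall D, measurable D -> mu D = (complex.Re (inner (E D x) x))%:E,
        mu.-integrable setT (fun t => (t ^+ 2)%:E) &
        inner (B x) x = (\int[mu]_(t in setT) t)%R%:C].

(** The scalar measures of [x + y] and [x - y] coincide, because the cross
    terms [<E(C) x, y>] vanish; hence so do the values of the form of B there, and
    polarization gives the claim. *)
Lemma spectral_orth D D' x y : measurable D -> measurable D' ->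
  D `&` D' = set0 -> E D x = x -> E D' y = y -> rinner (B x) y = 0.
Proof.
move=> mD mD' DD' xD yD'.
have cross C : measurable C -> rinner (E C x) y = 0.
  move=> mC.
  have -> : E C x = E (C `&` D) x.
    have {1}-> : C = (C `&` D) `|` (C `&` ~` D) by rewrite -setIUr setUv setIT.
    have mCD : measurable (C `&` ~` D).
      by apply: measurableI => //; exact: measurableC.
    rewrite pvm_setU //; first last.
    - by rewrite setIACA setICr setI0.
    - exact: measurableI.
    rewrite -[in X in _ + X]xD pvm_disjoint ?addr0 //.
    by rewrite setICA setICr setI0.
  have mCD : measurable (C `&` D) by exact: measurableI.
  rewrite -yD' -pvm_sym // pvm_disjoint ?rinner0 //.
  by rewrite -setIA DD' setI0.
have [mu [muE _ Bmu]] := EB (x + y).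
have [nu [nuE _ Bnu]] := EB (x - y).
have : rinner (B (x + y)) (x + y) = rinner (B (x - y)) (x - y).
  rewrite /rinner Bmu Bnu; congr (complex.Re (_%:C)); congr fine.
  apply: eq_measure_integral => C mC _; rewrite muE // nuE //; congr _%:E.
  rewrite -!/(rinner _ _) linearB linearD /= !rinnerE.
  have c1 := cross _ mC.
  have -> : rinner (E C y) x = 0 by rewrite pvm_sym // rinnerC.
  by rewrite c1; ring.
by rewrite linearB linearD /= !rinnerE (symB y x) (rinnerC y (B x)); lra.
Qed.

Lemma spectral_invariant D x : measurable D -> E D x = x -> E D (B x) = B x.
Proof.
move=> mD xD; have mD' := measurableC mD.
have Bx : E (~` D) (B x) = 0.
  apply/rnorm_eq0/eqP; rewrite -sqrf_eq0 rnorm_sqr pvm_sym // pvm_idem //.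
  apply/eqP; apply: (spectral_orth mD mD') => //; first by rewrite setICr.
  by rewrite pvm_idem.
by rewrite -[RHS](pvm_setC _ mD) Bx addr0.
Qed.

(** Integrability of the square gives integrability of t, as the measure is
    finite and [|t| <= 1 + t^2]. *)
Lemma spectral_first_moment x :
  exists mu : {measure set (measurableTypeR R) -> \bar R},
    [/\ forall D, measurable D -> mu D = (rinner (E D x) x)%:E,
        forall c, mu.-integrable setT (fun=> c%:E),
        mu.-integrable setT (fun t : measurableTypeR R => t%:E) &
        rinner (B x) x = (\int[mu]_(t in setT) t)%R].
Proof.
have [mu [muE mu2 Bmu]] := EB x; exists mu.
have cmu c : mu.-integrable setT (fun=> c%:E).
  apply/integrableP; split; first exact: measurable_cst.
  by rewrite integral_cst //= muE // -EFinM ltry.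
split=> //; last by rewrite /rinner Bmu.
have := integrableD measurableT (cmu 1) mu2; apply: le_integrable => //.
  exact: EFin_measurable.
move=> t _ /=; rewrite lee_fin [leRHS]ger0_norm ?addr_ge0 ?sqr_ge0 //.
have : 0 <= (`|t| - 1) ^+ 2 by exact: sqr_ge0.
by rewrite -[t ^+ 2]real_normK ?num_real //; have := normr_ge0 t; nra.
Qed.

Lemma spectral_form_le D x l : measurable D -> E D x = x ->
  (forall t, D t -> t <= l) -> rinner (B x) x <= l * rnorm x ^+ 2.
Proof.
move=> mD xD Dl; have mD' := measurableC mD.
have [mu [muE cmu imu ->]] := spectral_first_moment x.
have muC : mu (~` D) = 0%E.
  by rewrite muE // -xD pvm_disjoint ?setICr // rinner0.
have -> : (rnorm x ^+ 2) = fine (mu setT).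
  by rewrite muE // (pvm_setT pE) rnorm_sqr.
rewrite -Rintegral_cst // /Rintegral.
rewrite (negligible_integral mD' measurableT imu muC).
rewrite (negligible_integral mD' measurableT (cmu l) muC) setDE setCK setTI.
apply: le_Rintegral => //.
- by apply: integrableS imu.
- by apply: integrableS (cmu l).
Qed.

Lemma spectral_form_ge D x l : measurable D -> E D x = x ->
  (forall t, D t -> l <= t) -> l * rnorm x ^+ 2 <= rinner (B x) x.
Proof.
move=> mD xD Dl; have mD' := measurableC mD.
have [mu [muE cmu imu ->]] := spectral_first_moment x.
have muC : mu (~` D) = 0%E.
  by rewrite muE // -xD pvm_disjoint ?setICr // rinner0.
have -> : (rnorm x ^+ 2) = fine (mu setT).
  by rewrite muE // (pvm_setT pE) rnorm_sqr.
rewrite -Rintegral_cst // /Rintegral.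
rewrite (negligible_integral mD' measurableT imu muC).
rewrite (negligible_integral mD' measurableT (cmu l) muC) setDE setCK setTI.
apply: le_Rintegral => //.
- by apply: integrableS (cmu l).
- by apply: integrableS imu.
Qed.

End SpectralMeasure.

(** * Operator norms *)

Section OperatorNorm.
Local Open Scope complex_scope.
Variables (R : realType) (H K : hilbertType R) (T : {linear H -> K}).
Hypothesis bT : bounded_op T.

Lemma opnorm_bound x : rnorm x <= 1 -> rnorm (T x) <= opnorm T.
Proof.
move=> x1; apply: ub_le_sup; last by exists x => //=; rewrite normE lecR.
have [C [C0 TC]] := bT; exists C => _ [y /= y1 <-].
apply: le_trans (TC y) _; rewrite -[leRHS]mulr1 ler_wpM2l ?(ltW C0) //.
by rewrite -lecR -normE.
Qed.

Lemma opnorm_ge0 : 0 <= opnorm T.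
Proof.
by apply: le_trans (rnorm_ge0 (T 0)) (opnorm_bound _); rewrite rnorm0.
Qed.

Lemma opnormP x : rnorm (T x) <= opnorm T * rnorm x.
Proof.
have [->|x0] := eqVneq x 0; first by rewrite linear0 !rnorm0 mulr0.
have n0 : 0 < rnorm x by rewrite rnorm_gt0.
rewrite -ler_pdivrMr // mulrC -[(_)^-1]ger0_norm ?invr_ge0 ?rnorm_ge0 //.
rewrite -rnormZ -linearZ; apply: opnorm_bound.
by rewrite rnormZ ger0_norm ?invr_ge0 ?rnorm_ge0 // mulVf ?gt_eqF.
Qed.

Lemma opnorm_le c : (forall x, rnorm x <= 1 -> rnorm (T x) <= c) ->
  opnorm T <= c.
Proof.
move=> Tc; apply: ge_sup; first by exists (rnorm (T 0)), 0; rewrite //= normr0.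
by move=> _ [x /= x1 <-]; apply: Tc; rewrite -lecR -normE.
Qed.

Lemma adjoint_bound (T' : K -> H) :
  adjoint T T' -> forall y, rnorm (T' y) <= opnorm T * rnorm y.
Proof.
move=> TT' y; have [->|y0] := eqVneq (rnorm (T' y)) 0.
  by rewrite mulr_ge0 ?opnorm_ge0 ?rnorm_ge0.
have n0 : 0 < rnorm (T' y) by rewrite lt_def y0 rnorm_ge0.
rewrite -(ler_pM2r n0) -expr2 rnorm_sqr.
have -> : rinner (T' y) (T' y) = rinner (T (T' y)) y by rewrite /rinner TT'.
apply: le_trans (rinner_le _ _) _.
by rewrite mulrAC ler_wpM2r ?rnorm_ge0 // opnormP.
Qed.

End OperatorNorm.

(** * Perturbation of the bottom of a form *)

Section Perturbation.
Local Open Scope complex_scope.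
Variables (R : realType) (H : hilbertType R).
Implicit Types (A B p : {linear H -> H}) (S : set H).

(** In the application S is a graph over the range of the projection p, and
    p B differs from A p on S by the off-diagonal part of B only.  If the form of
    B on S had its bottom b below [m - c], then [|(B - b) q|] would dominate
    [(m - b - c) |p q|], hence [|q|]. *)
Lemma form_ge_compression A B p S m c k :
  bounded_op B -> symmetric_op B -> bounded_op p ->
  real_subspace S -> (forall x, S x -> S (B x)) ->
  form_ge A m setT -> 0 < k ->
  (forall x, S x -> rnorm x <= k * rnorm (p x)) ->
  (forall x, S x -> rnorm (p (B x) - A (p x)) <= c * rnorm (p x)) ->
  form_ge B (m - c) S.
Proof.
move=> bB sB [C [C0 pC]] lS BS Am k0 pk pBA.
apply: form_ge_of_gaps => // b bm _.
have d0 : 0 < m - c - b by rewrite subr_gt0.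
exists ((m - c - b) / (k * C)); split; first by rewrite divr_gt0 ?mulr_gt0.
move=> q Sq; set x := p q.
have h1 : rinner (A x - b%:C *: x) x <=
    (C * rnorm (shift B b q) + c * rnorm x) * rnorm x.
  apply: le_trans (rinner_le _ _) _; rewrite ler_wpM2r ?rnorm_ge0 //.
  have -> : A x - b%:C *: x = p (shift B b q) - (p (B q) - A x).
    by rewrite shiftE linearB [p (_ *: _)]linearZ /= opprB [RHS]addrC subrKA.
  by apply: le_trans (rnormD _ _) _; rewrite rnormN lerD //; exact: pBA.
have h2 := Am x I.
have {}h1 : (m - c - b) * rnorm x <= C * rnorm (shift B b q).
  have [x0|x0] := eqVneq (rnorm x) 0.
    by rewrite x0 mulr0 mulr_ge0 ?rnorm_ge0 ?(ltW C0).
  have n0 : 0 < rnorm x by rewrite lt_def x0 rnorm_ge0.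
  by rewrite -(ler_pM2r n0); move: h1; rewrite !rinnerE -!rnorm_sqr; lra.
rewrite mulrAC ler_pdivrMr ?mulr_gt0 //.
have h3 := ler_wpM2l (ltW d0) (pk q Sq).
have h4 := ler_wpM2l (ltW k0) h1.
rewrite -/x in h3; lra.
Qed.

Lemma form_ge_split B S S' m :
  (forall x, S x -> S (B x)) ->
  (forall x y, S x -> S' y -> rinner x y = 0) ->
  (forall x, exists u v, [/\ S u, S' v & x = u + v]) ->
  symmetric_op B ->
  form_ge B m S -> form_ge B m S' -> form_ge B m setT.
Proof.
move=> BS orth dec sB Bm Bm' x _; have [u [v [Su Sv ->]]] := dec x.
rewrite linearD !rinnerE (sB v u) (rinnerC v (B u)) (rinnerC v u).
rewrite (orth _ _ (BS _ Su) Sv) (orth _ _ Su Sv) -!rnorm_sqr.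
by have := Bm _ Su; have := Bm' _ Sv; lra.
Qed.

Lemma delta_minus_le A B c : (exists x : H, x != 0) ->
  bounded_op A -> symmetric_op A -> bounded_op B -> symmetric_op B ->
  (forall m, form_ge A m setT -> form_ge B (m - c) setT) ->
  delta_minus A B <= c.
Proof.
move=> H0 bA sA bB sB AB.
have [a [aE Aa _]] := inf_spec_form H0 bA sA.
have [b [bE _ Bb]] := inf_spec_form H0 bB sB.
by rewrite /delta_minus aE bE /=; have := Bb _ (AB _ Aa); lra.
Qed.

Lemma orth_proj_bounded p S : orth_proj_onto p S -> bounded_op p.
Proof.
move=> pS; exists 1; split=> // x; rewrite mul1r.
have [Spx orth] := pS x.
have h : rinner (x - p x) (p x) = 0 by rewrite /rinner orth.
rewrite -(@ler_pXn2r _ 2) ?nnegrE ?rnorm_ge0 // -subr_ge0.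
have : 0 <= rnorm (x - p x) ^+ 2 by exact: sqr_ge0.
by move: h; rewrite !rinnerE (rinnerC (p x) x); lra.
Qed.

Lemma orth_proj_fixed p S x : orth_proj_onto p S -> S x -> p x = x.
Proof.
move=> pS Sx; have [Spx orth] := pS x.
apply/esym/subr0_eq/rnorm_eq0/eqP; rewrite -sqrf_eq0 rnorm_sqr rinnerDr rinnerNr.
by rewrite /rinner !orth // subrr.
Qed.

End Perturbation.


(** * The subspace frakQ *)

Section SpectralSubspace.
Local Open Scope complex_scope.
Variables (R : realType) (H H0 : hilbertType R) (J0 : {linear H0 -> H}).
Variables (E : set (measurableTypeR R) -> {linear H -> H}) (B : {linear H -> H}).
Hypotheses (EB : spectral_measure_of B E) (bB : bounded_op B)
  (sB : symmetric_op B).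
Variable l : R.

Let Elt := E [set t | t < l].
Let Eeq := E [set l].

Lemma measurable_lt : measurable ([set t | t < l] : set (measurableTypeR R)).
Proof.
rewrite (_ : [set t | t < l] = [set` `]-oo, l[ ]); first exact: measurable_itv.
by apply/seteqP; split => t /=; rewrite in_itv.
Qed.

Lemma measurable_pt : measurable ([set l] : set (measurableTypeR R)).
Proof. exact: measurable_set1. Qed.

(** On the range of [E {l}] the form of [B - l] vanishes, and a nonnegative
    form controls the operator. *)
Lemma spectral_eigenvector v : Eeq v = v -> B v = l%:C *: v.
Proof.
have [pE mE] := EB => Ev.
pose S := [set w | Eeq w = w].
have lS : real_subspace S.
  by split=> [x y Sx Sy|t x Sx]; rewrite /S /= ?linearD ?linearZ /= ?Sx ?Sy.
have BS x : S x -> S (B x).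
  by move=> Sx; apply: (spectral_invariant pE sB mE measurable_pt).
have Bl x : S x -> rinner (shift B l x) x = 0.
  move=> Sx; apply/eqP; rewrite shift_form subr_eq0 eq_le.
  rewrite (spectral_form_le pE mE measurable_pt Sx) => [|_ -> //].
  by rewrite (spectral_form_ge pE mE measurable_pt Sx) // => _ ->.
have D0 : form_ge (shift B l) 0 S by move=> x Sx; rewrite mul0r Bl.
have [C [C0 DC]] := nonneg_form_bound (bounded_shift l bB)
  (symmetric_shift l sB) lS (shift_invariant (S := S) l lS BS) D0.
apply/subr0_eq/rnorm_eq0/eqP; rewrite -shiftE -sqrf_eq0 eq_le sqr_ge0 andbT.
by apply: le_trans (DC _ Ev) _; rewrite Bl // mulr0.
Qed.

Lemma frakQ_invariant x : frakQ J0 E l x -> frakQ J0 E l (B x).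
Proof.
have [pE mE] := EB.
move=> [u [u' _ <-] [v [[v' _ vv'] [w _ wv]] <-]].
rewrite linearD /=; exists (B (Elt u')).
  exists (B (Elt u')) => //.
  apply: (spectral_invariant pE sB mE measurable_lt).
  exact: (pvm_idem pE _ measurable_lt).
exists (B v) => //; rewrite spectral_eigenvector; last first.
  by rewrite -vv'; exact: (pvm_idem pE _ measurable_pt).
split; first by exists (l%:C *: v'); rewrite // linearZ /= vv'.
by exists (l%:C *: w); rewrite // linearZ /= wv.
Qed.

(** frakQ is contained in the range of [E] at the half-line [t <= l]. *)
Lemma frakQ_form_le x : frakQ J0 E l x -> rinner (B x) x <= l * rnorm x ^+ 2.
Proof.
have [pE mE] := EB.
have mle : measurable ([set t | t < l] `|` [set l] : set (measurableTypeR R)).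
  by apply: measurableU; [exact: measurable_lt|exact: measurable_pt].
move=> [u [u' _ <-] [v [[v' _ <-] _] <-]].
apply: (spectral_form_le pE mE mle) => [|t [/ltW//|->//]].
have ltl : [set t : measurableTypeR R | t < l] `&` [set l] = set0.
  by apply/seteqP; split=> // t [/= tl tE]; rewrite tE ltxx in tl.
have ml := measurable_lt; have mp := measurable_pt.
rewrite linearD !(pvm_setU pE) // !(pvm_idem pE) //.
by rewrite !(pvm_disjoint pE) // 1?setIC // addr0 add0r.
Qed.

(** A vector orthogonal to frakQ is orthogonal to the range of [E] at
    [t < l], so it lies in the range of [E] at [l <= t]. *)
Lemma frakQ_orth_form_ge x : (forall y, frakQ J0 E l y -> rinner x y = 0) ->
  l * rnorm x ^+ 2 <= rinner (B x) x.
Proof.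
have [pE mE] := EB; have ml := measurable_lt => xQ.
apply: (spectral_form_ge pE mE (measurableC ml)) => [|t /= /negP]; last first.
  by rewrite -leNgt.
have Ex : Elt x = 0.
  apply/rnorm_eq0/eqP; rewrite -sqrf_eq0 rnorm_sqr (pvm_sym pE _ _ ml).
  apply/eqP/xQ; exists (E [set t | t < l] (Elt x)); first by exists (Elt x).
  exists 0; last by rewrite addr0.
  by split; exists 0; rewrite ?linear0.
by rewrite -[RHS](pvm_setC pE _ ml) -/Elt Ex add0r.
Qed.

End SpectralSubspace.

(** * Block operators *)

Section BlockOperators.
Local Open Scope complex_scope.
Variables (R : realType) (H H0 H1 : hilbertType R).
Variables (J0 : {linear H0 -> H}) (J1 : {linear H1 -> H}).
Hypothesis HJ : orth_decomposition J0 J1.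

Lemma rinner_decomposition x y x' y' :
  rinner (J0 x + J1 y) (J0 x' + J1 y') = rinner x x' + rinner y y'.
Proof.
rewrite !rinnerE (rinnerC (J1 y)) /rinner (orth_isom0 HJ) (orth_isom1 HJ).
by rewrite !(orth_orth HJ) /= addr0 add0r.
Qed.

Lemma rnorm_decomposition x y :
  rnorm (J0 x + J1 y) ^+ 2 = rnorm x ^+ 2 + rnorm y ^+ 2.
Proof. by rewrite rnorm_sqr rinner_decomposition -!rnorm_sqr. Qed.

Lemma rnorm_J0 x : rnorm (J0 x) = rnorm x.
Proof.
apply/eqP; rewrite -(@eqrXn2 _ 2) ?rnorm_ge0 // rnorm_sqr /rinner.
by rewrite (orth_isom0 HJ) -/(rinner _ _) -rnorm_sqr.
Qed.

Lemma rnorm_J1 x : rnorm (J1 x) = rnorm x.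
Proof.
apply/eqP; rewrite -(@eqrXn2 _ 2) ?rnorm_ge0 // rnorm_sqr /rinner.
by rewrite (orth_isom1 HJ) -/(rinner _ _) -rnorm_sqr.
Qed.

Lemma rnorm_le_decomposition x y :
  rnorm x <= rnorm (J0 x + J1 y) /\ rnorm y <= rnorm (J0 x + J1 y).
Proof.
have h := rnorm_decomposition x y.
have hx := sqr_ge0 (rnorm x); have hy := sqr_ge0 (rnorm y).
split; rewrite -(@ler_pXn2r _ 2) ?nnegrE ?rnorm_ge0 //.
by rewrite h; lra.
by rewrite h; lra.
Qed.

Variables (T : {linear H -> H}) (T00 : H0 -> H0) (T01 : H1 -> H0)
  (T10 : H0 -> H1) (T11 : H1 -> H1).
Hypothesis block : block_operator J0 J1 T T00 T01 T10 T11.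

Lemma block_bounded : bounded_op T00 -> bounded_op T01 -> bounded_op T10 ->
  bounded_op T11 -> bounded_op T.
Proof.
move=> [a [a0 ha]] [b [b0 hb]] [c [c0 hc]] [d [d0 hd]].
exists (a + b + (c + d)); split; first by rewrite !addr_gt0.
move=> h; have [x [y ->]] := orth_span HJ h.
rewrite block; have [hx hy] := rnorm_le_decomposition x y.
apply: le_trans (rnormD _ _) _; rewrite rnorm_J0 rnorm_J1.
apply: le_trans (lerD (rnormD _ _) (rnormD _ _)) _.
rewrite !mulrDl !lerD //; [apply: le_trans (ha _) _|apply: le_trans (hb _) _|
  apply: le_trans (hc _) _|apply: le_trans (hd _) _]; rewrite ler_wpM2l // ltW //.
Qed.

Lemma block_symmetric : symmetric_op T00 -> symmetric_op T11 ->
  (forall x y, rinner (T01 y) x = rinner y (T10 x)) -> symmetric_op T.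
Proof.
move=> s0 s1 sV h h'.
have [x [y ->]] := orth_span HJ h; have [x' [y' ->]] := orth_span HJ h'.
rewrite !block !rinner_decomposition !rinnerE s0 s1 sV.
have -> : rinner (T10 x) y' = rinner x (T01 y') by rewrite rinnerC -sV rinnerC.
by ring.
Qed.

Lemma proj_J0 (P : {linear H -> H}) x y :
  orth_proj_onto P (range J0) -> P (J0 x + J1 y) = J0 x.
Proof.
move=> PJ0; have [[z _ zE] orth] := PJ0 (J0 x + J1 y).
rewrite -zE; congr (J0 _); apply/esym/subr0_eq/rnorm_eq0/eqP.
rewrite -sqrf_eq0 rnorm_sqr; apply/eqP.
have : rinner (J0 x + J1 y - P (J0 x + J1 y)) (J0 (x - z)) = 0.
  by rewrite /rinner orth //; exists (x - z).
rewrite -zE addrAC -linearB -[X in rinner _ X]addr0 -(linear0 J1).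
by rewrite rinner_decomposition (rinnerC y) rinner0 addr0.
Qed.

End BlockOperators.

(** * The operators of the theorem *)

Section Bounds.
Local Open Scope complex_scope.
Variables (R : realType) (H H0 H1 : hilbertType R).
Variables (J0 : {linear H0 -> H}) (J1 : {linear H1 -> H}).
Hypothesis HJ : orth_decomposition J0 J1.
Variables (A0 : {linear H0 -> H0}) (A1 : {linear H1 -> H1}).
Variables (V : {linear H1 -> H0}) (V' : {linear H0 -> H1}).
Hypotheses (bA0 : bounded_op A0) (sA0 : symmetric_op A0).
Hypotheses (bA1 : bounded_op A1) (sA1 : symmetric_op A1).
Hypotheses (bV : bounded_op V) (VV' : adjoint V V').
Variable l : R.
Hypotheses (A0l : (sup_spec A0 <= l%:E)%E) (lA1 : (l%:E <= inf_spec A1)%E).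
Variables A B : {linear H -> H}.
Hypotheses (A_block : block_operator J0 J1 A A0 (fun=> 0) (fun=> 0) A1)
  (B_block : block_operator J0 J1 B A0 V V' A1).
Variable E : set (measurableTypeR R) -> {linear H -> H}.
Hypothesis EB : spectral_measure_of B E.
Variable X : {linear H0 -> H1}.
Hypotheses (bX : bounded_op X) (XG : graph J0 J1 X = frakQ J0 E l).
Variables P Q : {linear H -> H}.
Hypotheses (PJ0 : orth_proj_onto P (range J0))
  (QG : orth_proj_onto Q (frakQ J0 E l)).

Let v := opnorm V.
Let k := opnorm X.
Let G := frakQ J0 E l.
Let G' : set H := [set h | forall q, G q -> rinner h q = 0].

Let v0 : 0 <= v. Proof. exact: opnorm_ge0. Qed.
Let k0 : 0 <= k. Proof. exact: opnorm_ge0. Qed.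

Let bA : bounded_op A.
Proof.
by apply: (block_bounded HJ A_block) => //; exists 1; split=> // x;
  rewrite rnorm0 mul1r rnorm_ge0.
Qed.

Let sA : symmetric_op A.
Proof.
apply: (block_symmetric HJ A_block) => // x y.
by rewrite rinner0 rinnerC rinner0.
Qed.

Let V'_bound y : rnorm (V' y) <= v * rnorm y.
Proof. exact: adjoint_bound. Qed.

Let bB : bounded_op B.
Proof.
apply: (block_bounded HJ B_block) => //; exists (v + 1).
split; first by rewrite ltr_wpDl.
by move=> x; apply: le_trans (V'_bound x) _; rewrite ler_wpM2r ?rnorm_ge0 // lerDl.
Qed.

Let sB : symmetric_op B.
Proof. by apply: (block_symmetric HJ B_block) => // x y; rewrite /rinner VV'. Qed.

Let bP : bounded_op P.
Proof. exact: orth_proj_bounded PJ0. Qed.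

Let graphP q : G q -> exists x, q = J0 x + J1 (X x).
Proof. by rewrite /G -XG => -[x _ <-]; exists x. Qed.

Let graphQ x : G (J0 x + J1 (X x)).
Proof. by rewrite /G -XG; exists x. Qed.

Let subspaceG : real_subspace G.
Proof.
split=> [x y /graphP[x' ->] /graphP[y' ->]|t x /graphP[x' ->]].
  by rewrite addrACA -!linearD.
by rewrite scalerDr -!linearZ.
Qed.

Let subspaceG' : real_subspace G'.
Proof.
split=> [x y Gx Gy q Gq|t x Gx q Gq]; first by rewrite rinnerDl Gx // Gy // addr0.
by rewrite rinnerZl Gx // mulr0.
Qed.

Let invG q : G q -> G (B q).
Proof. exact: frakQ_invariant. Qed.

Let invG' q : G' q -> G' (B q).
Proof. by move=> Gq z Gz; rewrite sB; apply/Gq/invG. Qed.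

Let decomp h : exists q q', [/\ G q, G' q' & h = q + q'].
Proof.
exists (Q h), (h - Q h); have [Gq orth] := QG h; split=> //.
  by move=> q /orth; rewrite /rinner => ->.
by rewrite addrC subrK.
Qed.

(** Orthogonality of [(x, y)] to [(x, X x)] reads [|x|^2 = - <y, X x>]. *)
Let orth_coord x y : G' (J0 x + J1 y) -> rnorm x <= k * rnorm y.
Proof.
move=> /(_ _ (graphQ x)); rewrite (rinner_decomposition HJ) -rnorm_sqr => h.
have [x0|x0] := eqVneq (rnorm x) 0; first by rewrite x0 mulr_ge0 ?rnorm_ge0.
have n0 : 0 < rnorm x by rewrite lt_def x0 rnorm_ge0.
rewrite -(ler_pM2r n0) -expr2.
have -> : rnorm x ^+ 2 = rinner (- y) (X x) by rewrite rinnerNl; lra.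
apply: le_trans (rinner_le _ _) _; rewrite rnormN mulrAC mulrC.
by rewrite ler_wpM2r ?rnorm_ge0 // opnormP.
Qed.

Let A_J0 x : A (J0 x) = J0 (A0 x).
Proof.
rewrite -[J0 x]addr0 -(linear0 J1) A_block.
by rewrite (linear0 A1) !addr0 linear0 addr0.
Qed.

Let A_J1 y : A (J1 y) = J1 (A1 y).
Proof.
rewrite -[J1 y]add0r -(linear0 J0) A_block.
by rewrite (linear0 A0) !add0r linear0 add0r.
Qed.

Let form_J0 m x : form_ge A m setT -> m * rnorm x ^+ 2 <= rinner (A0 x) x.
Proof.
move=> /(_ (J0 x) I); rewrite A_J0 (rnorm_J0 HJ).
by rewrite /rinner (orth_isom0 HJ).
Qed.

Let form_J1 m y : form_ge (\- A) m setT -> m * rnorm y ^+ 2 <= - rinner (A1 y) y.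
Proof.
move=> /(_ (J1 y) I); rewrite /= A_J1 (rnorm_J1 HJ) rinnerNl.
by rewrite /rinner (orth_isom1 HJ).
Qed.

(** A nonzero vector of H0 witnesses that the bottom of A is at most l. *)
Lemma delta_minus_bound : (exists x : H0, x != 0) ->
  delta_minus A B <= v * k.
Proof.
move=> [x0 x00]; apply: delta_minus_le => //.
  by exists (J0 x0); rewrite -rnorm_gt0 (rnorm_J0 HJ) rnorm_gt0.
move=> m Am; apply: (form_ge_split invG _ decomp sB).
- by move=> x y Gx Gy; rewrite rinnerC Gy.
- apply: (form_ge_compression (A := A) (p := P) (k := 1 + k)) => //.
  + by rewrite ltr_pwDl.
  + move=> q /graphP[x ->]; rewrite (proj_J0 HJ) // (rnorm_J0 HJ).
    apply: le_trans (rnormD _ _) _; rewrite (rnorm_J0 HJ) (rnorm_J1 HJ).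
    by rewrite mulrDl mul1r lerD2l opnormP.
  move=> q /graphP[x ->]; rewrite B_block !(proj_J0 HJ) //.
  rewrite A_J0 -linearB (addrC (A0 x)) addrK !(rnorm_J0 HJ) -mulrA.
  apply: le_trans (opnormP bV _) _; rewrite ler_wpM2l //; exact: opnormP.
have lm : m <= l.
  have lA0 : (- l%:E <= inf_spec (\- A0)%R)%E by rewrite leeNl -sup_specN.
  have H00 : exists x : H0, x != 0 by exists x0.
  have := inf_spec_le_form H00 (bounded_opN bA0) (symmetric_opN sA0) lA0.
  move=> /(_ x0 I); rewrite rinnerNl => h1; have h2 := form_J0 x0 Am.
  have n0 : 0 < rnorm x0 ^+ 2 by rewrite exprn_gt0 // rnorm_gt0.
  by rewrite -(ler_pM2r n0); lra.
apply: (@form_ge_le _ _ _ _ l).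
  by rewrite lerBlDr (le_trans lm) // lerDl mulr_ge0.
by move=> x Gx; exact: (frakQ_orth_form_ge (J0 := J0) EB Gx).
Qed.

Lemma delta_plus_bound : (exists y : H1, y != 0) ->
  delta_plus A B <= v * k.
Proof.
move=> [y0 y00]; rewrite delta_plusN; apply: delta_minus_le => //.
- by exists (J1 y0); rewrite -rnorm_gt0 (rnorm_J1 HJ) rnorm_gt0.
- exact: bounded_opN.
- exact: symmetric_opN.
- exact: bounded_opN.
- exact: symmetric_opN.
have coord1 x y : J0 x + J1 y - J0 x = J1 y by rewrite addrAC subrr add0r.
have NG q : G q -> G (- q).
  by rewrite -scaleN1r -(rmorphN1 (real_complex R)); apply: subspaceG.2.
have NG' q : G' q -> G' (- q).
  by rewrite -scaleN1r -(rmorphN1 (real_complex R)); apply: subspaceG'.2.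
move=> m Am; have invNG q : G q -> G ((\- B) q) by move=> ?; apply/NG/invG.
apply: (form_ge_split invNG _ decomp (symmetric_opN sB)).
- by move=> x y Gx Gy; rewrite rinnerC Gy.
- have ml : m <= - l.
    have H10 : exists y : H1, y != 0 by exists y0.
    have := inf_spec_le_form H10 bA1 sA1 lA1.
    move=> /(_ y0 I) h1; have h2 := form_J1 y0 Am.
    have n0 : 0 < rnorm y0 ^+ 2 by rewrite exprn_gt0 // rnorm_gt0.
    by rewrite -(ler_pM2r n0); lra.
  apply: (@form_ge_le _ _ _ _ (- l)).
    by rewrite lerBlDr (le_trans ml) // lerDl mulr_ge0.
  move=> x Gx; rewrite mulNr rinnerNl lerN2.
  exact: (frakQ_form_le EB Gx).
apply: (form_ge_compression (A := \- A) (p := idfun \- P) (k := 1 + k)) => //.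
- exact: bounded_opN.
- exact: symmetric_opN.
- apply: bounded_opB => //; exists 1; split=> // x; by rewrite mul1r.
- by move=> q Gq; apply/NG'/invG'.
- by rewrite ltr_pwDl.
- move=> q Gq; have [x [y qE]] := orth_span HJ q; rewrite qE in Gq *.
  rewrite /= (proj_J0 HJ) // coord1 (rnorm_J1 HJ).
  apply: le_trans (rnormD _ _) _; rewrite (rnorm_J0 HJ) (rnorm_J1 HJ).
  by rewrite addrC mulrDl mul1r lerD2l orth_coord.
move=> q Gq; have [x [y qE]] := orth_span HJ q; rewrite qE in Gq *.
have -> : (idfun \- P) ((\- B) (J0 x + J1 y)) -
    (\- A) ((idfun \- P) (J0 x + J1 y)) = - J1 (V' x).
  rewrite /= B_block (linearN P) !(proj_J0 HJ _ _ PJ0) coord1 A_J1 !opprK.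
  rewrite opprD [X in X + J1 _]addrAC addNr add0r linearD opprD.
  by rewrite -addrA addNr addr0.
rewrite /= (proj_J0 HJ) // coord1.
rewrite rnormN !(rnorm_J1 HJ) -mulrA.
by apply: le_trans (V'_bound _) _; rewrite ler_wpM2l //; exact: orth_coord.
Qed.

(** When H0 or H1 is zero, the off-diagonal part vanishes and A = B. *)
Lemma delta_le_opnormM : delta A B <= v * k.
Proof.
have [nz|/not_andP trivial_part] :=
  pselect ((exists x : H0, x != 0) /\ (exists y : H1, y != 0)).
  by rewrite /delta ge_max delta_minus_bound ?delta_plus_bound //; case: nz.
suff AB : (A : H -> H) = B.
  by rewrite /delta /delta_minus /delta_plus AB !subrr maxxx mulr_ge0.
suff [V0 V'0] : (forall y, V y = 0) /\ (forall x, V' x = 0).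
  apply/funext => h; have [x [y ->]] := orth_span HJ h.
  by rewrite A_block B_block V0 V'0.
have trivial (K : hilbertType R) :
    ~ (exists x : K, x != 0) -> forall x : K, x = 0.
  by move=> nx x; apply: contra_notP nx => /eqP; exists x.
case: trivial_part => /trivial z.
  by split=> [y|x]; [exact: z|rewrite (z x) linear0].
by split=> [y|x]; [rewrite (z y) linear0|exact: z].
Qed.

(** [Q - P] sends [(x, X x)] to [(0, X x)], whence
    [|X x|^2 <= n^2 (|x|^2 + |X x|^2)]. *)
Lemma opnorm_graph_le : let n := opnorm (Q \- P) in
  n < 1 -> k ^+ 2 * (1 - n ^+ 2) <= n ^+ 2.
Proof.
move=> n n1; have bQP : bounded_op (Q \- P).
  by apply: bounded_opB; [exact: orth_proj_bounded QG|exact: orth_proj_bounded PJ0].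
have n0 : 0 <= n by exact: (opnorm_ge0 bQP).
have n2 : 0 < 1 - n ^+ 2 by rewrite subr_gt0 exprn_ilt1.
have Xn x : rnorm x <= 1 -> rnorm (X x) ^+ 2 * (1 - n ^+ 2) <= n ^+ 2.
  move=> x1.
  have QPx : Q (J0 x + J1 (X x)) - P (J0 x + J1 (X x)) = J1 (X x).
    rewrite (proj_J0 HJ _ _ PJ0) (orth_proj_fixed QG (graphQ x)).
    by rewrite addrAC subrr add0r.
  have := opnormP bQP (J0 x + J1 (X x)); rewrite -/n /= QPx (rnorm_J1 HJ) => h.
  have : rnorm (X x) ^+ 2 <= n ^+ 2 * (rnorm x ^+ 2 + rnorm (X x) ^+ 2).
    rewrite -(rnorm_decomposition HJ) -exprMn lerXn2r ?nnegrE ?rnorm_ge0 //.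
    by rewrite mulr_ge0 ?rnorm_ge0.
  have : n ^+ 2 * rnorm x ^+ 2 <= n ^+ 2.
    by rewrite ler_piMr ?sqr_ge0 // expr_le1 ?rnorm_ge0.
  lra.
rewrite -ler_pdivlMr // -[leRHS]sqr_sqrtr ?divr_ge0 ?sqr_ge0 ?(ltW n2) //.
rewrite lerXn2r ?nnegrE ?sqrtr_ge0 //; apply: opnorm_le => // x x1.
rewrite -[leLHS]ger0_norm ?rnorm_ge0 // -sqrtr_sqr ler_wsqrtr //.
by rewrite ler_pdivlMr //; exact: Xn.
Qed.

End Bounds.

Theorem theorem3p1 (R : realType) (H H0 H1 : hilbertType R)
    (Hsep : separable H)
    (J0 : {linear H0 -> H}) (J1 : {linear H1 -> H})
    (HJ : orth_decomposition J0 J1)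
    (A0 : {linear H0 -> H0}) (A1 : {linear H1 -> H1})
    (V : {linear H1 -> H0}) (V' : {linear H0 -> H1})
    (A0_bounded : continuous A0) (A0_sa : selfadjoint A0)
    (A1_bounded : continuous A1) (A1_sa : selfadjoint A1)
    (V_bounded : continuous V) (V'_adj : adjoint V V')
    (lambda : R)
    (A0_lambda : (sup_spec A0 <= lambda%:E)%E)
    (lambda_A1 : (lambda%:E <= inf_spec A1)%E)
    (A B : {linear H -> H})
    (A_block : block_operator J0 J1 A A0 (fun=> 0) (fun=> 0) A1)
    (B_block : block_operator J0 J1 B A0 V V' A1)
    (E : set (measurableTypeR R) -> {linear H -> H})
    (E_B : spectral_measure_of B E)
    (X : {linear H0 -> H1})
    (X_bounded : continuous X) (X_contraction : opnorm X <= 1)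
    (X_graph : graph J0 J1 X = frakQ J0 E lambda)
    (P Q : {linear H -> H})
    (P_proj : orth_proj_onto P (range J0))
    (Q_proj : orth_proj_onto Q (frakQ J0 E lambda)) :
  delta A B <= opnorm V /\
  ((exists y, V y != 0) ->
   delta A B / opnorm V <= opnorm X /\
   delta A B / Num.sqrt (delta A B ^+ 2 + opnorm V ^+ 2)
     <= opnorm (Q \- P)).
Proof.
have bA0 := (continuous_bounded_op A0).1 A0_bounded.
have bA1 := (continuous_bounded_op A1).1 A1_bounded.
have bV := (continuous_bounded_op V).1 V_bounded.
have bX := (continuous_bounded_op X).1 X_bounded.
have sA0 := selfadjoint_symmetric A0_sa.
have sA1 := selfadjoint_symmetric A1_sa.
have d_vk : delta A B <= opnorm V * opnorm X.
  exact: (delta_le_opnormM HJ bA0 sA0 bA1 sA1 bV V'_adj A0_lambda lambda_A1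
    A_block B_block E_B bX X_graph P_proj Q_proj).
have k_n := opnorm_graph_le HJ bX X_graph P_proj Q_proj.
have v0 : 0 <= opnorm V by exact: opnorm_ge0.
have k0 : 0 <= opnorm X by exact: opnorm_ge0.
split; first by apply: le_trans d_vk _; rewrite ler_piMr.
move=> [y Vy]; have {v0} v0 : 0 < opnorm V.
  rewrite lt_def v0 andbT; apply: contra_neq Vy => v_eq0.
  apply/rnorm_eq0/le_anti; rewrite rnorm_ge0 andbT.
  by rewrite -(mul0r (rnorm y)) -v_eq0 opnormP.
split; first by rewrite ler_pdivrMr // mulrC.
have n0 : 0 <= opnorm (Q \- P).
  apply: opnorm_ge0; apply: bounded_opB.
    exact: orth_proj_bounded Q_proj.
  exact: orth_proj_bounded P_proj.
move: (opnorm (Q \- P)) n0 k_n => n n0 k_n.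
have [d0|d0] := leP (delta A B) 0.
  by apply: le_trans n0; rewrite mulr_le0_ge0 // invr_ge0 sqrtr_ge0.
have s2 : 0 < delta A B ^+ 2 + opnorm V ^+ 2 by rewrite addr_gt0 ?exprn_gt0.
have s0 : 0 < Num.sqrt (delta A B ^+ 2 + opnorm V ^+ 2) by rewrite sqrtr_gt0.
(* Otherwise n^2 v^2 < delta^2 (1 - n^2), whereas delta^2 <= v^2 k^2 and
   k^2 (1 - n^2) <= n^2. *)
rewrite ler_pdivrMr // leNgt; apply/negP => ns.
have {ns} ns : n ^+ 2 * (delta A B ^+ 2 + opnorm V ^+ 2) < delta A B ^+ 2.
  rewrite -[X in _ * X](sqr_sqrtr (ltW s2)) -exprMn ltrXn2r //.
  by rewrite mulr_ge0 ?(ltW s0).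
have d2 : 0 < delta A B ^+ 2 by rewrite exprn_gt0.
have v2 : 0 < opnorm V ^+ 2 by rewrite exprn_gt0.
have n1 : n < 1.
  rewrite ltNge; apply/negP => n1.
  have : 1 <= n ^+ 2 by rewrite exprn_ege1.
  by move=> h; have := ler_wpM2r (ltW s2) h; lra.
have {}k_n := k_n n1.
have d_vk2 : delta A B ^+ 2 <= opnorm V ^+ 2 * opnorm X ^+ 2.
  by rewrite -exprMn lerXn2r ?nnegrE ?mulr_ge0 ?(ltW v0) ?(ltW d0).
have n2 : 0 <= 1 - n ^+ 2 by rewrite subr_ge0 expr_le1 // ltW.
have := ler_wpM2r n2 d_vk2; have := ler_wpM2l (ltW v2) k_n; lra.
Qed.
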